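(* Let $k\ge3$ and let $G$, $G'$ be non-isomorphic regular (simple) graphs. If $G$ and $G'$ are $A$-cospectral, then the subdivision hypergraphs $S(G^{k})$ and $S(G'^{k})$ are non-isomorphic and $A$-cospectral.
   Context: A hypergraph consists of a finite vertex set and hyperedges, which are vertex subsets of size at least $2$. For a $k$-uniform hypergraph (all hyperedges of size $k$) with vertices $v_1,\dots,v_N$, the adjacency matrix $A$ has $A_{ij}=\frac{d_{ij}}{k-1}$ for $i\neq j$, where $d_{ij}$ is the number of hyperedges containing both $v_i,v_j$, and $A_{ii}=0$ (for graphs this is the usual adjacency matrix). Two (hyper)graphs are $A$-cospectral if their adjacency matrices have the same multiset of eigenvalues. The $k$-th power $G^{k}$ ($k\ge3$) of a graph $G=(V,E)$ is the $k$-uniform hypergraph whose vertex set is $V$ together with $k-2$ new distinct vertices $i_{e,1},\dots,i_{e,k-2}$ for each edge $e\in E$, and whose hyperedges are $e\cup\{i_{e,1},\dots,i_{e,k-2}\}$, $e\in E$. Subdivision of a hyperedge $e$ of cardinality $k$: add a new vertex $p_e$, delete $e$, and add the $k$ hyperedges $\{p_e\}\cup(e\setminus\{v\})$, $v\in e$. The subdivision hypergraph $S(H)$ is obtained by subdividing every hyperedge of $H$. *)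

(* Defs.v *)
From HB Require Import structures.
From mathcomp Require Import all_boot all_order all_algebra all_field.
Set Implicit Arguments.
Unset Strict Implicit.
Unset Printing Implicit Defensive.
Import GRing.Theory.
Local Open Scope ring_scope.

Record hypergraph := Hypergraph {
  vertex :> finType;
  hyperedges : {set {set vertex}};
  hyperedges_gt1 : forall e, e \in hyperedges -> (1 < #|e|)%N }.

(* A simple graph is a 2-uniform hypergraph. *)
Definition uniform (k : nat) (H : hypergraph) : Prop :=
  forall e, e \in hyperedges H -> #|e| = k.

Definition degree (H : hypergraph) (v : H) : nat :=
  #|[set e in hyperedges H | v \in e]|.

Definition regular (H : hypergraph) : Prop :=
  exists r : nat, forall v : H, degree v = r.

Definition isomorphic (H H' : hypergraph) : Prop :=
  exists f : H -> H', bijective f /\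
    forall e : {set H}, (f @: e \in hyperedges H') = (e \in hyperedges H).

Definition codegree (H : hypergraph) (u v : H) : nat :=
  #|[set e in hyperedges H | (u \in e) && (v \in e)]|.

(* Meaningful for k-uniform H, the vertices being numbered by [enum_val]. *)
Definition adjacency_mx (k : nat) (H : hypergraph) : 'M[algC]_#|H| :=
  \matrix_(i, j) if i == j then 0
                 else (codegree (enum_val i) (enum_val j))%:R / (k.-1)%:R.

(* The eigenvalues with their algebraic multiplicities, as a list of roots of
   the (monic) characteristic polynomial; only its class up to [perm_eq] is
   significant. *)
Definition spectrum (n : nat) (A : 'M[algC]_n) : seq algC :=
  sval (closed_field_poly_normal (char_poly A)).

Definition A_cospectral (k : nat) (H H' : hypergraph) : Prop :=
  perm_eq (spectrum (adjacency_mx k H)) (spectrum (adjacency_mx k H')).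

Lemma char_poly_spectrum n (A : 'M[algC]_n) :
  char_poly A = \prod_(a <- spectrum A) ('X - a%:P).
Proof.
rewrite /spectrum; case: closed_field_poly_normal => s /= {1}->.
by rewrite (monicP (char_poly_monic A)) scale1r.
Qed.

Lemma mem_spectrum n (A : 'M[algC]_n) (a : algC) :
  (a \in spectrum A) = eigenvalue A a.
Proof. by rewrite eigenvalue_root_char char_poly_spectrum root_prod_XsubC. Qed.

Lemma size_spectrum n (A : 'M[algC]_n) : size (spectrum A) = n.
Proof.
by apply: succn_inj; rewrite -(size_char_poly A) char_poly_spectrum size_prod_XsubC.
Qed.

Definition edge_type (H : hypergraph) : finType :=
  {e : {set H} | e \in hyperedges H}.

Section Power.
Variables (k : nat) (G : hypergraph).

(* [inr (e, j)] is the j-th new vertex attached to the edge e. *)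
Definition power_vertex : finType := (G + edge_type G * 'I_(k - 2))%type.

Definition power_edge (e : edge_type G) : {set power_vertex} :=
  [set inl v | v in val e] :|: [set inr (e, j) | j : 'I_(k - 2)].

Definition power_edges : {set {set power_vertex}} :=
  [set power_edge e | e : edge_type G].

Lemma card_power_edge e : #|power_edge e| = (#|val e| + (k - 2))%N.
Proof.
rewrite cardsU disjoint_setI0 ?cards0 ?subn0; last first.
  by apply/pred0P=> x /=; apply/andP=> -[/imsetP[v _ ->] /imsetP[]].
rewrite !card_imset ?cardsT ?card_ord //; first by move=> u v [].
by move=> i j [].
Qed.

Lemma power_edges_gt1 e : e \in power_edges -> (1 < #|e|)%N.
Proof.
case/imsetP=> e0 _ ->; rewrite card_power_edge ltn_addr //.
exact: hyperedges_gt1 (valP e0).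
Qed.

Definition power : hypergraph := Hypergraph power_edges_gt1.

Lemma power_uniform : (2 <= k)%N -> uniform 2 G -> uniform k power.
Proof.
move=> k2 G2 _ /imsetP[e _ ->]; rewrite card_power_edge (G2 _ (valP e)).
exact: subnKC.
Qed.

End Power.

Section Subdivision.
Variable H : hypergraph.

(* [inr e] is the new vertex p_e. *)
Definition subdiv_vertex : finType := (H + edge_type H)%type.

Definition subdiv_edge (e : edge_type H) (v : H) : {set subdiv_vertex} :=
  (inr e : subdiv_vertex) |: [set inl u | u in val e :\ v].

Definition subdiv_edges : {set {set subdiv_vertex}} :=
  [set subdiv_edge e v | e : edge_type H, v : H in val e].

Lemma card_subdiv_edge (e : edge_type H) (v : H) : v \in val e -> #|subdiv_edge e v| = #|val e|.
Proof.
move=> ve; rewrite cardsU1 card_imset; last by move=> x y [].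
rewrite (cardsD1 v (val e)) ve; congr (nat_of_bool _ + _)%N.
by apply/imsetP=> -[].
Qed.

Lemma subdiv_edges_gt1 e : e \in subdiv_edges -> (1 < #|e|)%N.
Proof.
case/imset2P=> e0 v _ ve ->; rewrite card_subdiv_edge //.
exact: hyperedges_gt1 (valP e0).
Qed.

Definition subdivision : hypergraph := Hypergraph subdiv_edges_gt1.

Lemma subdivision_uniform k : uniform k H -> uniform k subdivision.
Proof.
move=> Hk _ /imset2P[e v _ ve ->]; rewrite card_subdiv_edge //.
exact: Hk (valP e).
Qed.

End Subdivision.

(* Main.v *)
(** Let [G] be [r]-regular with adjacency matrix [A] and incidence matrix [N].
    Ordering the vertices of the subdivision of [G^k] by the edge of [G] they
    come from, its adjacency matrix is [[a A, N (x) t], [N^T (x) t^T, I (x) T]]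
    with [a = (k-2)/(k-1)] and [t], [T] depending only on [k].  For all but
    finitely many [x], Schur complementation turns its characteristic
    polynomial at [x] into [det (x I - T) ^ m] times the determinant of
    [x I - a A - s N N^T], where [m] is the number of edges and
    [s = t (x I - T)^-1 t^T].  As [N N^T = A + r I], this depends only on [k],
    [r], [m], [x] and the characteristic polynomial of [A]; and [r], the
    spectral radius, and hence [m], are determined by the latter.

    Conversely, in the subdivision of [G^k] the vertices of [G], the other
    vertices of [G^k] and the vertices [p_e] have degrees [(k-1) r], [k-1] and
    [k].  So for [r >= 2] an isomorphism preserves the vertices of [G], on which
    the codegree is [k-2] times that of [G], hence positive exactly on the edges
    of [G].  For [r <= 1] the order of [G] determines [G] up to isomorphism. *)

Require Import Defs.
From mathcomp Require Import all_boot all_order all_algebra all_field.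
From mathcomp Require Import perm ring zify.
Set Implicit Arguments.
Unset Strict Implicit.
Unset Printing Implicit Defensive.
Import Order.TTheory GRing.Theory Num.Theory.

(** * Determinants over finite types *)

Section FinTypeDeterminant.
Local Open Scope ring_scope.
Variable K : comNzRingType.

(** Two enumerations of [T] differ by a permutation. It acts on rows and columns alike, so its sign
    occurs squared. *)
Lemma det_reindex (T : Type) (F : T -> T -> K) n p
    (g : 'I_n -> T) (h : 'I_p -> T) :
    bijective g -> bijective h ->
  \det (\matrix_(i, j) F (g i) (g j)) = \det (\matrix_(i, j) F (h i) (h j)).
Proof.
move=> [g' gK g'K] [h' hK h'K].
have bf : bijective (g' \o h).
  by exists (h' \o g) => i /=; rewrite ?g'K ?hK ?h'K ?gK.
have Enp : p = n by have := bij_eq_card bf; rewrite !card_ord.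
case: _ / Enp g g' gK g'K bf => g g' gK g'K bf.
pose s := perm (bij_inj bf).
have -> : \matrix_(i, j) F (h i) (h j) =
          row_perm s (col_perm s (\matrix_(i, j) F (g i) (g j))).
  by apply/matrixP=> i j; rewrite !mxE !permE /= !g'K.
rewrite row_permE col_permE !det_mulmx !det_perm odd_permV mulrC -mulrA.
by rewrite -expr2 sqrr_sign mulr1.
Qed.

(** Indexing by a finite type lets block decompositions follow sum types; by [fdet_bij] the
    enumeration does not matter. *)
Definition fdet (T : finType) (F : T -> T -> K) : K :=
  \det (\matrix_(i < #|T|, j < #|T|) F (enum_val i) (enum_val j)).

Lemma fdet_bij (T T' : finType) (h : T -> T') (F : T' -> T' -> K) :
  bijective h -> fdet F = fdet (fun x y => F (h x) (h y)).
Proof.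
move=> bh; have bg := enum_val_bij T'.
exact: (det_reindex F bg (bij_comp bh (enum_val_bij T))).
Qed.

Lemma eq_fdet (T : finType) (F F' : T -> T -> K) :
  F =2 F' -> fdet F = fdet F'.
Proof. by move=> eF; congr (\det _); apply/matrixP=> i j; rewrite !mxE. Qed.

(* [Y] solves the lower block row, so that a unipotent column operation makes
   the matrix block triangular. *)
Lemma fdet_schur (V R : finType) (F : V + R -> V + R -> K) (Y : R -> V -> K) :
    (forall r v, \sum_s F (inr r) (inr s) * Y s v = - F (inr r) (inl v)) ->
  fdet F =
    fdet (fun u v => F (inl u) (inl v) + \sum_r F (inl u) (inr r) * Y r v) *
    fdet (fun r s => F (inr r) (inr s)).
Proof.
move=> FY.
(* This enumeration lists [V] before [R], so that the matrix becomes a literal [block_mx]. *)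
pose g (i : 'I_(#|V| + #|R|)) : V + R :=
  match split i with inl a => inl (enum_val a) | inr b => inr (enum_val b) end.
have bg : bijective g.
  exists (fun x => unsplit (match x with
    inl v => inl (enum_rank v) | inr r => inr (enum_rank r) end)) => [i|x].
    rewrite /g -[RHS]splitK; case: (split i) => a /=; by rewrite enum_valK.
  by rewrite /g unsplitK; case: x => x; rewrite enum_rankK.
rewrite {1}/fdet (det_reindex F (enum_val_bij _) bg).
pose P := \matrix_(i < #|V|, j < #|V|)
  F (inl (enum_val i)) (inl (enum_val j)).
pose Q := \matrix_(i < #|V|, j < #|R|)
  F (inl (enum_val i)) (inr (enum_val j)).
pose Q' := \matrix_(i < #|R|, j < #|V|)
  F (inr (enum_val i)) (inl (enum_val j)).
pose D := \matrix_(i < #|R|, j < #|R|)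
  F (inr (enum_val i)) (inr (enum_val j)).
pose Z := \matrix_(i < #|R|, j < #|V|) Y (enum_val i) (enum_val j).
have -> : \matrix_(i, j) F (g i) (g j) = block_mx P Q Q' D.
  apply/matrixP=> i j; rewrite !mxE /g.
  by case: (split i) => a; rewrite !mxE; case: (split j) => b; rewrite !mxE.
have sumE (f : R -> K) : \sum_(i < #|R|) f (enum_val i) = \sum_r f r.
  by rewrite [RHS](reindex _ (onW_bij _ (enum_val_bij R))).
have DZ : D *m Z = - Q'.
  apply/matrixP=> i j; rewrite !mxE -FY -sumE.
  by apply: eq_bigr => s _; rewrite !mxE.
rewrite -[LHS]mulr1.
have -> : 1 = \det (block_mx 1%:M 0 Z 1%:M : 'M[K]_(#|V| + #|R|)).
  by rewrite det_lblock !det1 mulr1.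
rewrite -det_mulmx mulmx_block !mulmx1 !mulmx0 DZ subrr !add0r det_ublock.
congr (_ * _); congr (\det _); apply/matrixP=> i j; rewrite !mxE -sumE.
by congr (_ + _); apply: eq_bigr => s _; rewrite !mxE.
Qed.

End FinTypeDeterminant.

(** * Characteristic polynomials and cospectrality *)

Section CharacteristicPolynomial.
Local Open Scope ring_scope.

Lemma horner_char_poly (R : comNzRingType) n (A : 'M[R]_n) x :
  (char_poly A).[x] = \det (x%:M - A).
Proof.
rewrite /char_poly -/(horner_eval x _) -det_map_mx; congr (\det _).
apply/matrixP=> i j; rewrite !mxE /=.
by rewrite /horner_eval /= hornerD hornerN hornerC hornerMn hornerX.
Qed.

(** In both cases [A] enters only through its size and characteristic polynomial, which cospectral
    graphs share. The case [d = 0] is kept because [a + schur_coef] may vanish at some points. *)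
Lemma det_scalar_sub (K : fieldType) n (A : 'M[K]_n) c d :
  \det (c%:M - d *: A) =
    if d == 0 then c ^+ n else d ^+ n * (char_poly A).[c / d].
Proof.
case: eqP => [->|/eqP d0]; first by rewrite scale0r subr0 det_scalar.
by rewrite horner_char_poly -detZ scalerBr scale_scalar_mx mulrC divfK.
Qed.

(** The product [p * (f - g)] vanishes everywhere, in particular at as many distinct naturals as its
    size, hence is zero. *)
Lemma poly_eq_off_roots (p f g : {poly algC}) :
  p != 0 -> (forall x, p.[x] != 0 -> f.[x] = g.[x]) -> f = g.
Proof.
move=> p0 fg; apply/eqP; rewrite -subr_eq0.
suff: p * (f - g) = 0 by move/eqP; rewrite mulf_eq0 (negPf p0).
set q := p * _.
apply: (@roots_geq_poly_eq0 _ q [seq i%:R | i <- iota 0 (size q)]).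
- apply/allP=> x _; rewrite /root hornerM hornerD hornerN mulf_eq0.
  by have [//|/fg->] := eqVneq p.[x] 0; rewrite subrr eqxx.
- by rewrite map_inj_uniq ?iota_uniq // => i j /eqP; rewrite eqr_nat => /eqP.
- by rewrite size_map size_iota.
Qed.

Lemma A_cospectralP k (H H' : hypergraph) :
  A_cospectral k H H' <->
  char_poly (adjacency_mx k H) = char_poly (adjacency_mx k H').
Proof.
split=> [coH | E]; last by rewrite /A_cospectral /spectrum E.
by rewrite !char_poly_spectrum; apply: perm_big.
Qed.

Lemma A_cospectral_card k (H H' : hypergraph) :
  A_cospectral k H H' -> #|H| = #|H'|.
Proof. by move/perm_size; rewrite !size_spectrum. Qed.

Lemma horner_char_poly_adjacency k (H : hypergraph) x :
  (char_poly (adjacency_mx k H)).[x] =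
  fdet (fun u v : H => if u == v then x else - ((codegree u v)%:R / k.-1%:R)).
Proof.
rewrite horner_char_poly; congr (\det _); apply/matrixP=> i j.
by rewrite !mxE (inj_eq enum_val_inj); case: eqP; rewrite ?subr0 ?sub0r.
Qed.

End CharacteristicPolynomial.

(** * Codegrees in powers and subdivisions *)

Lemma card_imset_sub (aT rT : finType) (f : aT -> rT) (P : pred rT) :
  injective f ->
  #|[set y in [set f x | x : aT] | P y]| = #|[set x | P (f x)]|.
Proof.
move=> f_inj; rewrite -(card_imset (mem [set x | P (f x)]) f_inj).
congr (#|pred_of_set _|); apply/setP=> y; rewrite inE; apply/andP/imsetP.
  by case=> /imsetP[x _ ->] Px; exists x; rewrite ?inE.
by case=> x; rewrite inE => Px ->; split=> //; apply: imset_f.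
Qed.

Lemma codegreeE (H : hypergraph) (u v : H) :
  codegree u v = #|[set e : edge_type H | (u \in val e) && (v \in val e)]|.
Proof.
rewrite -(card_imset_sub (fun e : {set H} => (u \in e) && (v \in e))) //;
  last exact: val_inj.
congr (#|pred_of_set _|); apply/setP=> e; rewrite !inE; congr (_ && _).
apply/idP/imsetP=> [He | [e' _ ->]]; last exact: (valP e').
by exists (exist _ e He : edge_type H).
Qed.

Lemma codegreeC (H : hypergraph) (u v : H) : codegree u v = codegree v u.
Proof. by apply: eq_card => e; rewrite !inE; congr (_ && _); rewrite andbC. Qed.

Lemma codegree_xx (H : hypergraph) (v : H) : codegree v v = degree v.
Proof. by congr (#|pred_of_set _|); apply/setP=> e; rewrite !inE andbb. Qed.

Lemma codegree_gt0 (G : hypergraph) (u v : G) :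
  uniform 2 G -> u != v -> (0 < codegree u v) = ([set u; v] \in hyperedges G).
Proof.
move=> G2 uv; apply/card_gt0P/idP=> [[e] | Euv]; last first.
  by exists [set u; v]; rewrite !inE Euv !eqxx orbT.
rewrite !inE => /and3P[Ee ue ve].
suff -> : [set u; v] = e by [].
by apply/eqP; rewrite eqEcard subUset !sub1set ue ve cards2 uv (G2 _ Ee).
Qed.

Section PowerCodegree.
Variables (k : nat) (G : hypergraph).

Lemma mem_power_edge_inl (e : edge_type G) (v : G) :
  (inl v \in power_edge k e) = (v \in val e).
Proof.
rewrite in_setU mem_imset; last by move=> ? ? [].
by case: imsetP => [[? _] //|_]; rewrite orbF.
Qed.

Lemma mem_power_edge_inr (e f : edge_type G) (i : 'I_(k - 2)) :
  (inr (f, i) \in power_edge k e) = (f == e).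
Proof.
rewrite in_setU; case: imsetP => [[? _] //|_] /=.
by apply/imsetP/eqP=> [[j _ [->]] // | ->]; exists i.
Qed.

Lemma power_edge_inj : injective (@power_edge k G).
Proof.
move=> e f Eef; apply/val_inj/setP=> v.
by rewrite -!mem_power_edge_inl Eef.
Qed.

Lemma power_edge_hyperedge (e : edge_type G) :
  power_edge k e \in hyperedges (power k G).
Proof. exact: imset_f. Qed.

Definition power_edge_of (e : edge_type G) : edge_type (power k G) :=
  exist _ (power_edge k e) (power_edge_hyperedge e).

Lemma power_edge_of_bij : bijective power_edge_of.
Proof.
have inj : injective power_edge_of.
  by move=> e f /(congr1 val)/= /power_edge_inj.
apply: inj_card_bij => //; rewrite card_sig.
by rewrite (card_imset _ power_edge_inj).
Qed.

Lemma codegree_power (x y : power_vertex k G) :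
  codegree (x : power k G) (y : power k G) =
  #|[set e : edge_type G | (x \in power_edge k e) && (y \in power_edge k e)]|.
Proof.
exact: (card_imset_sub (fun e : {set power k G} => (x \in e) && (y \in e))
         power_edge_inj).
Qed.

Lemma codegree_power_ll (u v : G) :
  codegree (inl u : power k G) (inl v : power k G) = codegree u v.
Proof.
rewrite codegree_power codegreeE; apply: eq_card => e.
by rewrite in_set [RHS]in_set !mem_power_edge_inl.
Qed.

Lemma codegree_power_lr (u : G) (e : edge_type G) (i : 'I_(k - 2)) :
  codegree (inl u : power k G) (inr (e, i) : power k G) = (u \in val e).
Proof.
rewrite codegree_power; case: (boolP (u \in val e)) => ue.
  apply/eqP/cards1P; exists e; apply/setP=> f.
  rewrite in_set in_set1 mem_power_edge_inl mem_power_edge_inr eq_sym andbC.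
  by case: eqP => // ->.
apply/eqP; rewrite cards_eq0; apply/eqP/setP=> f.
rewrite in_set in_set0 mem_power_edge_inl mem_power_edge_inr andbC.
by case: eqP => //= <-; apply: negPf.
Qed.

Lemma codegree_power_rr (e f : edge_type G) (i j : 'I_(k - 2)) :
  codegree (inr (e, i) : power k G) (inr (f, j) : power k G) = (e == f).
Proof.
rewrite codegree_power; case: eqP => [<- | nef].
  apply/eqP/cards1P; exists e; apply/setP=> f'.
  by rewrite in_set in_set1 !mem_power_edge_inr andbb eq_sym.
apply/eqP; rewrite cards_eq0; apply/eqP/setP=> f'.
rewrite in_set in_set0 !mem_power_edge_inr.
by apply/andP=> -[/eqP ef /eqP ff']; case: nef; rewrite ef ff'.
Qed.

End PowerCodegree.

Section SubdivisionCodegree.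
Variables (k : nat) (H : hypergraph).
Hypothesis Hk : uniform k H.

Lemma mem_subdiv_edge_inl (e : edge_type H) (v u : H) :
  (inl u \in subdiv_edge e v) = (u != v) && (u \in val e).
Proof. by rewrite !inE /= mem_imset ?inE // => ? ? []. Qed.

Lemma mem_subdiv_edge_inr (e f : edge_type H) (v : H) :
  (inr f \in subdiv_edge e v) = (f == e).
Proof. by rewrite !inE /=; case: imsetP => [[? _] //|_]; rewrite orbF. Qed.

(** Hyperedges of the subdivision correspond to pairs [(e, v)] with [v] in [e]: the new vertex
    determines [e], and [v] is the only vertex of [e] left out. *)
Lemma codegree_subdivision (x y : subdiv_vertex H) :
  codegree (x : subdivision H) (y : subdivision H) =
  \sum_(e : edge_type H)
    #|[set v in val e | (x \in subdiv_edge e v) && (y \in subdiv_edge e v)]|.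
Proof.
pose D := [set p : edge_type H * H | (p.2 \in val p.1) &&
  ((x \in subdiv_edge p.1 p.2) && (y \in subdiv_edge p.1 p.2))].
pose h (p : edge_type H * H) := subdiv_edge p.1 p.2.
have h_inj : {in D &, injective h}.
  move=> [e v] [f w]; rewrite !inE /h /= => /andP[ve _] /andP[wf _] /setP Eh.
  have Eef : e = f.
    by move: (Eh (inr e)); rewrite !mem_subdiv_edge_inr eqxx => /esym/eqP.
  subst f; congr (_, _); apply/eqP.
  move: (Eh (inl v)); rewrite !mem_subdiv_edge_inl eqxx ve !andbT /=.
  by move/esym/negbFE.
have -> : @codegree (subdivision H) x y = #|D|.
  rewrite -(card_in_imset h_inj); apply: eq_card => s; rewrite inE.
  apply/andP/imsetP=> [[/imset2P[e v _ ve ->] xy] | [[e v]]].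
    by exists (e, v); rewrite // in_set /= ve.
  by rewrite inE /= => /andP[ve xy] ->; split=> //; apply/imset2P; exists e v.
rewrite -sum1_card (eq_bigl _ _ (fun p => in_set _ p)).
rewrite -(pair_big_dep predT (fun (e : edge_type H) (v : H) => (v \in val e) &&
  ((x \in subdiv_edge e v) && (y \in subdiv_edge e v))) (fun _ _ => 1)) /=.
by apply: eq_bigr => e _; rewrite -sum1_card; apply: eq_bigl => v; rewrite in_set.
Qed.

(** Each hyperedge through [u] and [w] yields one new hyperedge per deleted vertex outside [{u, w}],
    a set of size [(u != w).+1]. *)
Lemma codegree_subdivision_ll (u w : H) :
  codegree (inl u : subdivision H) (inl w : subdivision H) =
  (k - (u != w).+1) * codegree u w.
Proof.
rewrite codegree_subdivision codegreeE mulnC -sum_nat_const [RHS]big_mkcond /=.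
apply: eq_bigr => e _; rewrite inE; case: ifP => [/andP[ue we] | uwe].
  rewrite -(Hk (valP e)) -cards2.
  have sub : [set u; w] \subset val e by rewrite subUset !sub1set ue we.
  have <- : #|val e :\: [set u; w]| = #|val e| - #|[set u; w]|.
    by rewrite cardsD (setIidPr sub).
  apply: eq_card => v; rewrite in_set !mem_subdiv_edge_inl in_setD in_set2 ue we !andbT.
  by rewrite negb_or andbC ![_ == v]eq_sym.
apply/eqP; rewrite cards_eq0; apply/eqP/setP=> v.
rewrite in_set in_set0 !mem_subdiv_edge_inl andbACA uwe !andbF //.
Qed.

Lemma codegree_subdivision_lr (u : H) (e : edge_type H) :
  codegree (inl u : subdivision H) (inr e : subdivision H) =
  (u \in val e) * k.-1.
Proof.
rewrite codegree_subdivision (bigD1 e) //= big1 ?addn0 => [|f nfe]; last first.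
  apply/eqP; rewrite cards_eq0; apply/eqP/setP=> v.
  by rewrite in_set in_set0 mem_subdiv_edge_inr eq_sym (negPf nfe) !andbF.
case: (boolP (u \in val e)) => ue; rewrite ?mul1n ?mul0n.
  rewrite -(Hk (valP e)) (cardsD1 u (val e)) ue add1n /=.
  apply: eq_card => v; rewrite in_set in_setD1 mem_subdiv_edge_inl mem_subdiv_edge_inr.
  by rewrite ue eqxx !andbT andbC eq_sym.
apply/eqP; rewrite cards_eq0; apply/eqP/setP=> v.
by rewrite in_set in_set0 mem_subdiv_edge_inl (negPf ue) !andbF.
Qed.

Lemma codegree_subdivision_rr (e f : edge_type H) :
  codegree (inr e : subdivision H) (inr f : subdivision H) = (e == f) * k.
Proof.
rewrite codegree_subdivision (bigD1 e) //= big1 ?addn0 => [|f' nfe]; last first.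
  apply/eqP; rewrite cards_eq0; apply/eqP/setP=> v.
  by rewrite in_set in_set0 !mem_subdiv_edge_inr eq_sym (negPf nfe) !andbF.
case: eqP => [<- | nef]; rewrite ?mul1n ?mul0n.
  rewrite -(Hk (valP e)).
  by apply: eq_card => v; rewrite in_set !mem_subdiv_edge_inr eqxx !andbT.
apply/eqP; rewrite cards_eq0; apply/eqP/setP=> v.
by rewrite in_set in_set0 !mem_subdiv_edge_inr eqxx eq_sym (introF eqP nef) !andbF.
Qed.

End SubdivisionCodegree.

Lemma isomorphic_codegree (H H' : hypergraph) (f : H -> H') :
    bijective f ->
    (forall e : {set H}, (f @: e \in hyperedges H') = (e \in hyperedges H)) ->
  forall u v, codegree (f u) (f v) = codegree u v.
Proof.
move=> bf Ef u v; have fI := bij_inj bf; have [f' fK f'K] := bf.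
rewrite /codegree -(card_imset (mem [set e in hyperedges H | (u \in e) && (v \in e)])
  (imset_inj fI)).
apply: eq_card => e'; rewrite inE; apply/idP/imsetP=> [|[e]].
  have Ee' : e' = f @: (f' @: e').
    by rewrite -imset_comp (eq_imset _ (f'K : f \o f' =1 id)) imset_id.
  rewrite {1 2 3}Ee' Ef !mem_imset // => He; exists (f' @: e') => //.
  by rewrite inE.
by rewrite inE => He ->; rewrite Ef !mem_imset.
Qed.

(** * The characteristic polynomial of the subdivision *)

Section BigSums.
Local Open Scope ring_scope.

Lemma sum_delta (R : pzSemiRingType) (I : finType) (i : I) (f : I -> R) :
  \sum_j (i == j)%:R * f j = f i.
Proof.
rewrite (bigD1 i) //= eqxx mul1r big1 ?addr0 // => j.
by rewrite eq_sym => /negPf->; rewrite mul0r.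
Qed.

Lemma sum_pair (V : nmodType) (I J : finType) (f : I * J -> V) :
  \sum_p f p = \sum_i \sum_j f (i, j).
Proof. by rewrite pair_bigA; apply: eq_bigr => -[]. Qed.

End BigSums.

Section SchurComplement.
Local Open Scope ring_scope.
Variables (k : nat) (x : algC).
Hypothesis k3 : (3 <= k)%N.

Local Notation q := ((k - 2)%:R : algC).
Let a : algC := q / k.-1%:R.

(* ['X] times the characteristic polynomial of [[a (q - 1), 1], [q, 0]], the
   quotient of [T] by the partition into the [k - 2] power vertices and [p_e]. *)
Definition cell_poly : {poly algC} :=
  'X * ('X ^+ 2 - (q / k.-1%:R * (q - 1)) *: 'X - q%:P).

(* [y] and [z] are the entries of [(x I - T)^-1 t^T] on the power vertices and
   on [p_e]. *)
Let y : algC := (a * x + 1) / (x ^+ 2 - a * (q - 1) * x - q).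
Let z : algC := (1 + q * y) / x.
(** The scalar [t (x I - T)^-1 t^T]: the row [t] is [a] on the [q] power vertices and [1] on
    [p_e]. *)
Definition schur_coef : algC := a * q * y + z.

Section EdgeBlock.
Variable E : finType.

(* [I (x) (x I - T)] *)
Definition edge_block (r s : E * 'I_(k - 2) + E) : algC :=
  match r, s with
  | inl (e, i), inl (f, j) => (e == f)%:R * (if i == j then x else - a)
  | inl (e, _), inr f => - (e == f)%:R
  | inr e, inl (f, _) => - (e == f)%:R
  | inr e, inr f => (e == f)%:R * x
  end.

End EdgeBlock.

(** The entries see edges only through equality tests, so a bijection of the index types suffices
    and the determinant is never computed. *)
Lemma fdet_edge_block_card (E E' : finType) :
  #|E| = #|E'| -> fdet (@edge_block E) = fdet (@edge_block E').
Proof.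
move=> EE.
pose h (e : E) : E' := enum_val (cast_ord EE (enum_rank e)).
pose h' (e : E') : E := enum_val (cast_ord (esym EE) (enum_rank e)).
have hK : cancel h h' by move=> e; rewrite /h /h' enum_valK cast_ordK enum_rankK.
have h'K : cancel h' h by move=> e; rewrite /h /h' enum_valK cast_ordKV enum_rankK.
have hI := can_inj hK.
pose H (r : E * 'I_(k - 2) + E) : E' * 'I_(k - 2) + E' :=
  match r with inl p => inl (h p.1, p.2) | inr e => inr (h e) end.
pose H' (r : E' * 'I_(k - 2) + E') : E * 'I_(k - 2) + E :=
  match r with inl p => inl (h' p.1, p.2) | inr e => inr (h' e) end.
rewrite (fdet_bij (h := H)); last first.
  by exists H' => -[[e i]|e] /=; rewrite ?hK ?h'K.
apply: eq_fdet => -[[e i]|e] [[f j]|f] /=; by rewrite (inj_eq hI).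
Qed.

Variable G : hypergraph.
Hypothesis G2 : uniform 2 G.
Local Notation E := (edge_type G).

(** Regroups the vertices into those of [G] and those attached to an edge of [G], the two blocks of
    [fdet_schur]. *)
Definition flatten_vertex (w : G + (E * 'I_(k - 2) + E)) :
    subdivision (power k G) :=
  match w with
  | inl v => inl (inl v)
  | inr (inl p) => inl (inr p)
  | inr (inr e) => inr (power_edge_of k e)
  end.

Lemma flatten_vertex_bij : bijective flatten_vertex.
Proof.
have [g gK Kg] := power_edge_of_bij k G.
exists (fun w : subdiv_vertex (power k G) => match w with
  | inl (inl v) => inl v | inl (inr p) => inr (inl p) | inr e => inr (inr (g e))
  end) => [[v|[p|e]]|[[v|p]|e]] //=; by rewrite ?gK ?Kg.
Qed.

Definition flat_entry (w w' : G + (E * 'I_(k - 2) + E)) : algC :=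
  match w, w' with
  | inl u, inl v => if u == v then x else - (a * (codegree u v)%:R)
  | inl u, inr (inl (e, _)) => - (a * (u \in val e)%:R)
  | inl u, inr (inr e) => - (u \in val e)%:R
  | inr (inl (e, _)), inl u => - (a * (u \in val e)%:R)
  | inr (inr e), inl u => - (u \in val e)%:R
  | inr r, inr s => edge_block r s
  end.

Lemma predn_neq0 : k.-1%:R != 0 :> algC.
Proof. by rewrite pnatr_eq0; case: k k3 => [|[]]. Qed.

(** Subdividing multiplies the codegree of distinct power vertices by [k - 2], whence the factor [a]
    after normalisation; a vertex of a hyperedge shares [k - 1] new hyperedges with its [p_e],
    whence the entry [1]. *)
Lemma flat_entryE w w' :
  (if flatten_vertex w == flatten_vertex w' then x
   else - ((codegree (flatten_vertex w) (flatten_vertex w'))%:R / k.-1%:R)) =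
  flat_entry w w'.
Proof.
have Hk := power_uniform (ltnW k3) G2; have kn0 := predn_neq0.
rewrite (inj_eq (bij_inj flatten_vertex_bij)).
have ll (u v : power k G) : u != v ->
    (codegree (inl u : subdivision (power k G)) (inl v : subdivision _))%:R /
      k.-1%:R = a * (codegree u v)%:R :> algC.
  move=> uv; rewrite (codegree_subdivision_ll Hk) uv natrM /a.
  by rewrite mulrAC.
have lr (u : power k G) (e : E) :
    (codegree (inl u : subdivision (power k G))
      (inr (power_edge_of k e) : subdivision _))%:R /
      k.-1%:R = (u \in power_edge k e)%:R :> algC.
  by rewrite (codegree_subdivision_lr Hk) natrM mulfK.
case: w w' => [u|[[e i]|e]] [v|[[f j]|f]] /=.
- rewrite (inj_eq (@inl_inj _ _)); case: eqP => // /eqP uv.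
  by rewrite ll ?codegree_power_ll.
- by rewrite ll // codegree_power_lr.
- by rewrite lr mem_power_edge_inl.
- by rewrite codegreeC ll // codegree_power_lr.
- case: eqP => [[<- <-]|]; first by rewrite !eqxx mul1r.
  move=> /eqP ij; rewrite ll // codegree_power_rr.
  move: ij; case: (eqVneq e f) => [->|] /=; rewrite ?mulr0 ?mul0r ?oppr0 //.
  by case: (eqVneq i j) => [->|]; rewrite ?eqxx // mul1r mulr1.
- by rewrite lr mem_power_edge_inr.
- by rewrite codegreeC lr mem_power_edge_inl.
- by rewrite codegreeC lr mem_power_edge_inr eq_sym.
- rewrite (codegree_subdivision_rr Hk) (inj_eq (bij_inj (power_edge_of_bij k G))).
  rewrite (inj_eq (@inr_inj _ _)) (inj_eq (@inr_inj _ _)).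
  by case: eqP; rewrite ?mul1r // !mul0r oppr0.
Qed.

(** The entries of [N N^T]. *)
Lemma sum_incidence (u v : G) :
  \sum_(e : E) (u \in val e)%:R * (v \in val e)%:R = (codegree u v)%:R :> algC.
Proof.
rewrite codegreeE -sum1_card natr_sum [RHS]big_mkcond /=.
apply: eq_bigr => e _; rewrite inE -natrM mulnb.
by case: (_ && _).
Qed.

Variable r : nat.
Hypothesis Gr : forall v : G, degree v = r.
Hypothesis x_generic : cell_poly.[x] != 0.

(** The matrix [N^T (x) (x I - T)^-1 t^T], serving as [Y] in [fdet_schur]. *)
Definition column_op (s : E * 'I_(k - 2) + E) (v : G) : algC :=
  match s with
  | inl (e, _) => (v \in val e)%:R * y
  | inr e => (v \in val e)%:R * z
  end.

(** By symmetry among the power vertices of an edge, the system with matrix [x I - T] and right side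
    [t^T] reduces to two equations, one for a power vertex and one for [p_e]. *)
Lemma cell_equations :
  (x - a * (q - 1)) * y - z = a /\ x * z - q * y = 1.
Proof.
(* [cell_poly] at [x] is the product of the denominators of [z] and [y]. *)
have : x * (x ^+ 2 - a * (q - 1) * x - q) != 0.
  by move: x_generic; rewrite /cell_poly !hornerE.
rewrite mulf_eq0 negb_or => /andP[x0 d0].
by rewrite /z /y; split; field; rewrite x0 d0 ?predn_neq0.
Qed.

(** Only the block of the edge of [s] contributes; there the claim is one of [cell_equations] times
    an incidence. *)
Lemma column_op_solves s v :
  \sum_t flat_entry (inr s) (inr t) * column_op t v =
  - flat_entry (inr s) (inl v).
Proof.
have [eq1 eq2] := cell_equations.
rewrite big_sumType /= sum_pair.
case: s => [[e i]|e] /=; rewrite opprK.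
- under eq_bigr => f _ do under eq_bigr => j _ do rewrite -mulrA.
  under eq_bigr => f _ do rewrite -mulr_sumr.
  under [X in _ + X]eq_bigr => f _ do rewrite mulNr -mulrN.
  rewrite !sum_delta -mulr_suml -[in RHS]eq1 (bigD1 i) //= eqxx.
  rewrite (eq_bigr (fun=> - a)); last by move=> j /negPf; rewrite eq_sym => ->.
  rewrite sumr_const cardC1 card_ord -(mulr_natr (- a)).
  (* Counts the other power vertices of the edge; truncated subtraction is exact as [k >= 3]. *)
  have -> : (k - 2).-1%:R = q - 1 by rewrite -subn1 natrB // subn_gt0.
  clear eq1 eq2; clearbody z y a; ring.
- under eq_bigr => f _ do rewrite sumr_const card_ord mulNr mulNrn -mulrnAr -mulrN.
  under [X in _ + X]eq_bigr => f _ do rewrite -mulrA.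
  rewrite !sum_delta -[RHS]mulr1 -eq2; clear eq1 eq2; clearbody z y a; ring.
Qed.

Lemma horner_char_poly_subdivision_power :
  (char_poly (adjacency_mx k (subdivision (power k G)))).[x] =
  \det ((x - schur_coef * r%:R)%:M - (a + schur_coef) *: adjacency_mx 2 G) *
  fdet (@edge_block E).
Proof.
rewrite horner_char_poly_adjacency (fdet_bij _ flatten_vertex_bij).
rewrite (eq_fdet flat_entryE) (fdet_schur column_op_solves).
congr (_ * _); last by apply: eq_fdet => -[[? ?]|?] [[? ?]|?].
congr (\det _); apply/matrixP=> i j; rewrite !mxE.
set u := enum_val i; set v := enum_val j.
(* The Schur correction is [- schur_coef] times [N N^T], whose diagonal [r] shifts [x] below. *)
have -> : \sum_s flat_entry (inl u) (inr s) * column_op s v =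
          - (schur_coef * (codegree u v)%:R).
  rewrite big_sumType /= sum_pair.
  under [X in X + _]eq_bigr => f _ do rewrite sumr_const card_ord -(mulr_natr (_ * _)).
  rewrite -big_split /= -sum_incidence mulr_sumr -sumrN; apply: eq_bigr => f _.
  rewrite /schur_coef; clearbody z y a; ring.
rewrite /= (inj_eq enum_val_inj) divr1; case: eqP => [Eij|_].
  by rewrite /v -Eij codegree_xx Gr mulr0 subr0.
by rewrite mulr0n sub0r [in RHS]mulrDl opprD.
Qed.

End SchurComplement.

Lemma cell_poly_neq0 k : cell_poly k != 0%R.
Proof.
(* The polynomial is monic of degree 3. *)
apply/eqP=> /polyP/(_ 3); rewrite /cell_poly !coefE /= mulr0 !subr0.
by move/eqP; rewrite oner_eq0.
Qed.

(** * Regular graphs *)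

(** Double counting: each edge at [u] has exactly one other end. *)
Lemma codegree_sum (G : hypergraph) (u : G) :
  uniform 2 G -> \sum_(v | v != u) codegree u v = degree u.
Proof.
move=> G2; rewrite -codegree_xx codegreeE -sum1dep_card.
under eq_bigr => v _ do rewrite codegreeE -sum1dep_card.
rewrite (exchange_big_dep (fun e : edge_type G => u \in val e)) /=; last first.
  by move=> v e _ /andP[].
apply: eq_big => e; rewrite ?andbb // => ue; rewrite sum1dep_card.
have := G2 _ (valP e); rewrite (cardsD1 u) ue add1n => -[<-].
by apply: eq_card => v; rewrite !inE.
Qed.

Lemma degree_sum (G : hypergraph) :
  uniform 2 G -> \sum_(v : G) degree v = #|edge_type G| * 2.
Proof.
move=> G2; under eq_bigr => v _ do rewrite -codegree_xx codegreeE -sum1dep_card.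
rewrite (exchange_big_dep (fun e : edge_type G => true)) //= -sum_nat_const.
apply: eq_bigr => e _; rewrite sum1dep_card -(G2 _ (valP e)).
by apply: eq_card => v; rewrite !inE andbb.
Qed.

Section RegularSpectrum.
Local Open Scope ring_scope.
Variables (G : hypergraph) (r : nat).
Hypotheses (G2 : uniform 2 G) (Gr : forall v : G, degree v = r).

Local Notation A := (adjacency_mx 2 G).

Lemma adjacency_row_sum i : \sum_j A i j = r%:R.
Proof.
rewrite -(Gr (enum_val i)) -(codegree_sum (enum_val i) G2) natr_sum.
rewrite [RHS](reindex _ (onW_bij _ (enum_val_bij G))) /= big_mkcond [RHS]big_mkcond.
apply: eq_bigr => j _; rewrite mxE (inj_eq enum_val_inj) eq_sym.
by case: eqP => //; rewrite divr1.
Qed.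

Lemma adjacency_ge0 i j : 0 <= A i j.
Proof. by rewrite mxE; case: eqP => // _; rewrite divr1 ler0n. Qed.

Lemma adjacency_sym i j : A i j = A j i.
Proof. by rewrite !mxE eq_sym codegreeC. Qed.

Lemma eigenvalue_degree : (0 < #|G|)%N -> eigenvalue A r%:R.
Proof.
(* Eigenvectors are rows here, so the row sums are used through the symmetry of [A]. *)
move=> n0; apply/eigenvalueP; exists (const_mx 1).
  apply/rowP=> j; rewrite !mxE mulr1 -(adjacency_row_sum j).
  by apply: eq_bigr => i _; rewrite mxE mul1r adjacency_sym.
by apply/eqP=> /rowP/(_ (Ordinal n0)) /eqP; rewrite !mxE oner_eq0.
Qed.

Lemma eigenvalue_norm_le c : eigenvalue A c -> `|c| <= r%:R.
Proof.
case/eigenvalueP=> v /rowP vA /rV0Pn[i0 vi0].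
(* A coordinate of largest modulus; [algC] is only partially ordered, but moduli are real and hence
   comparable. *)
have [i _ imax] := @real_arg_maxP algC 'I_#|G| i0 xpredT
  (fun i => `|v 0 i|) isT (fun j _ => normr_real (v 0 j)).
have vi : 0 < `|v 0 i|.
  by apply: lt_le_trans (imax i0 isT); rewrite normr_gt0.
have := esym (vA i); rewrite [X in X = _]mxE [X in _ = X]mxE => cv.
rewrite -(ler_pM2r vi) -normrM cv -(adjacency_row_sum i) mulr_suml.
apply: le_trans (ler_norm_sum _ _ _) _; apply: ler_sum => j _.
rewrite normrM mulrC (ger0_norm (adjacency_ge0 j i)) adjacency_sym.
by apply: ler_wpM2l; [apply: adjacency_ge0 | apply: imax].
Qed.

End RegularSpectrum.

(** The degree [r] is an eigenvalue of [G], hence of [G'], where [r'] bounds all moduli. *)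
Lemma A_cospectral_degree_le (G G' : hypergraph) r r' :
    uniform 2 G -> uniform 2 G' ->
    (forall v : G, degree v = r) -> (forall v : G', degree v = r') ->
    0 < #|G| -> A_cospectral 2 G G' ->
  r <= r'.
Proof.
move=> G2 G2' Gr Gr' n0 coG.
have := eigenvalue_degree G2 Gr n0.
rewrite -mem_spectrum (perm_mem coG) mem_spectrum => /(eigenvalue_norm_le G2' Gr').
by rewrite normr_nat ler_nat.
Qed.

(** * Reconstruction of the graph *)

Lemma isomorphic_of_codegree (G G' : hypergraph) (f : G -> G') :
    uniform 2 G -> uniform 2 G' -> bijective f ->
    (forall u v, u != v ->
      (0 < codegree (f u) (f v)) = (0 < codegree u v)) ->
  isomorphic G G'.
Proof.
move=> G2 G2' bf fE; have fI := bij_inj bf; exists f; split=> // e.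
have [/cards2P[u [v [uv ->]]] | ne2] := boolP (#|e| == 2).
  by rewrite imsetU1 imset_set1 -!codegree_gt0 ?(inj_eq fI) // fE.
apply/idP/idP=> [/G2' | /G2]; last by move/eqP; rewrite (negPf ne2).
by rewrite card_imset // => /eqP; rewrite (negPf ne2).
Qed.

Lemma bij_of_card (T T' : finType) :
  #|T| = #|T'| -> exists f : T -> T', bijective f.
Proof.
move=> TT; exists (fun x => enum_val (cast_ord TT (enum_rank x))).
apply: inj_card_bij; last by rewrite TT.
by move=> x y /enum_val_inj /cast_ord_inj /enum_rank_inj.
Qed.

Lemma edgeless_isomorphic (G G' : hypergraph) :
    uniform 2 G -> uniform 2 G' ->
    (forall v : G, degree v = 0) -> (forall v : G', degree v = 0) ->
  #|G| = #|G'| -> isomorphic G G'.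
Proof.
move=> G2 G2' G0 G0' /bij_of_card[f bf].
have cd0 (H : hypergraph) : (forall v : H, degree v = 0) ->
    forall u v : H, codegree u v = 0.
  move=> H0 u v; apply/eqP; rewrite -leqn0 -(H0 u); apply: subset_leq_card.
  by apply/subsetP=> e; rewrite !inE => /and3P[-> ->].
by apply: (isomorphic_of_codegree G2 G2' bf) => u v _; rewrite !cd0.
Qed.

(** In a perfect matching a vertex is determined by its edge and by whether it is the end chosen for
    that edge. *)
Lemma matching_coordinates (G : hypergraph) :
    uniform 2 G -> (forall v : G, degree v = 1) ->
  exists g : G -> edge_type G * bool, bijective g /\
    forall u v, (0 < codegree u v) = ((g u).1 == (g v).1).
Proof.
move=> G2 G1.
have ex_edge v : exists e : edge_type G, v \in val e.
  have /eqP/cards1P[e /setP Ee] := G1 v.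
  have := Ee e; rewrite !inE eqxx => /andP[He ve].
  by exists (exist _ e He).
pose ed v := xchoose (ex_edge v); have edP v : v \in val (ed v) := xchooseP (ex_edge v).
have edE v (e : edge_type G) : (v \in val e) = (ed v == e).
  apply/idP/eqP=> [ve | <- //]; apply: val_inj.
  have /eqP/cards1P[e0 /setP Ee] := G1 v.
  have := Ee (val (ed v)); have := Ee (val e).
  rewrite !inE (valP e) (valP (ed v)) ve edP /=.
  by move=> /esym/eqP -> /esym/eqP.
have ex_end (e : edge_type G) : exists v, v \in val e.
  by apply/card_gt0P; rewrite (G2 _ (valP e)).
pose end1 e := xchoose (ex_end e).
have end1P e : end1 e \in val e := xchooseP (ex_end e).
pose g v := (ed v, v == end1 (ed v)); exists g; split.
  (* The handshake identity gives equal cardinalities, so injectivity suffices. *)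
  apply: inj_card_bij; last first.
    rewrite card_prod card_bool -degree_sum // (eq_bigr (fun=> 1)) //.
    by rewrite sum1_card.
  move=> u v [Euv]; rewrite -Euv => uv.
  (* Without its chosen end the edge has a single vertex [w], so two vertices that are not the
     chosen end coincide. *)
  have /eqP := G2 _ (valP (ed u)); rewrite (cardsD1 (end1 (ed u))) end1P.
  case/cards1P=> w /setP Ew; have := Ew u; have := Ew v.
  rewrite !inE edP [v \in _]edE Euv eqxx !andbT -Euv -uv.
  case: (u =P end1 (ed u)) uv => [Eu /esym/eqP Ev _ _ | _ _].
    by rewrite Ev.
  by move=> /esym/eqP-> /esym/eqP.
move=> u v; rewrite codegreeE; apply/card_gt0P/eqP=> [[e] | /= Euv].
  by rewrite inE !edE /= => /andP[/eqP-> /eqP->].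
by exists (ed v); rewrite inE !edE Euv eqxx.
Qed.

Lemma matching_isomorphic (G G' : hypergraph) :
    uniform 2 G -> uniform 2 G' ->
    (forall v : G, degree v = 1) -> (forall v : G', degree v = 1) ->
  #|edge_type G| = #|edge_type G'| -> isomorphic G G'.
Proof.
move=> G2 G2' G1 G1' /bij_of_card[phi bphi].
have [g [bg gE]] := matching_coordinates G2 G1.
have [g' [[h hK g'K] g'E]] := matching_coordinates G2' G1'.
pose Phi (p : edge_type G * bool) := (phi p.1, p.2).
have bPhi : bijective Phi.
  by have [psi psiK phiK] := bphi; exists (fun p => (psi p.1, p.2)) => -[e b] /=;
    rewrite /Phi /= ?psiK ?phiK.
have bh : bijective h by exists g'.
apply: (isomorphic_of_codegree G2 G2' (bij_comp bh (bij_comp bPhi bg))).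
move=> u v _; rewrite g'E gE /= !g'K /=; exact: inj_eq (bij_inj bphi) _ _.
Qed.

Lemma isomorphic_subdivision_power k (G G' : hypergraph) r :
    3 <= k -> 2 <= r -> uniform 2 G -> uniform 2 G' ->
    (forall v : G, degree v = r) -> (forall v : G', degree v = r) ->
    #|G| = #|G'| ->
    isomorphic (subdivision (power k G)) (subdivision (power k G')) ->
  isomorphic G G'.
Proof.
move=> k3 r2 G2 G2' Gr Gr' GG [f [bf fE]].
have Hk := power_uniform (ltnW k3) G2; have Hk' := power_uniform (ltnW k3) G2'.
have cf := isomorphic_codegree bf fE.
have exg (u : G) : exists v : G', f (inl (inl u)) == inl (inl v).
  (* Degrees decide: [(k - 1) r] differs from [k - 1] because [r >= 2], and exceeds [k] because
     [k >= 3] as well. *)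
  have := cf (inl (inl u)) (inl (inl u)).
  rewrite (codegree_subdivision_ll Hk) codegree_power_ll (codegree_xx u) Gr eqxx /=.
  case: (f _) => [[v _|[e i]]|e]; first by exists v.
    rewrite (codegree_subdivision_ll Hk') eqxx codegree_power_rr eqxx.
    by move=> /eqP; rewrite eqn_mul2l; lia.
  rewrite (codegree_subdivision_rr Hk') eqxx; nia.
pose g u := xchoose (exg u).
have gP u : f (inl (inl u)) = inl (inl (g u)) := eqP (xchooseP (exg u)).
have gI : injective g.
  move=> u v Eg; have := gP u; rewrite Eg -gP => /(bij_inj bf) Euv.
  by case: Euv.
have bg : bijective g by apply: inj_card_bij; rewrite ?GG.
apply: (isomorphic_of_codegree G2 G2' bg) => u v uv.
have := cf (inl (inl u)) (inl (inl v)); rewrite !gP.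
rewrite (codegree_subdivision_ll Hk) (codegree_subdivision_ll Hk').
have neq (H : hypergraph) (a b : H) : ((inl a : power k H) != inl b) = (a != b).
  by [].
rewrite !neq (inj_eq gI) uv !codegree_power_ll => /eqP.
by rewrite eqn_pmul2l ?subn_gt0 // => /eqP->.
Qed.

(** * Transfer of cospectrality and conclusion *)

Lemma A_cospectral_regular (G G' : hypergraph) :
    uniform 2 G -> uniform 2 G' -> regular G -> regular G' ->
    A_cospectral 2 G G' ->
  exists r, (forall v : G, degree v = r) /\ (forall v : G', degree v = r).
Proof.
move=> G2 G2' [r Gr] [r' Gr'] coG; have GG := A_cospectral_card coG.
(* Empty graphs are regular of every degree, so [r] and [r'] may differ there and a common value is
   chosen. *)
have [n0 | n0] := posnP #|G|.
  by exists 0; split=> v; exfalso; [move: n0 | move: n0; rewrite GG];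
    move/card0_eq/(_ v).
exists r; suff rr : r = r' by split=> // v; rewrite rr.
apply/eqP; rewrite eqn_leq (A_cospectral_degree_le G2 G2' Gr Gr' n0 coG).
rewrite (A_cospectral_degree_le G2' G2 Gr' Gr) -?GG //.
by rewrite /A_cospectral perm_sym.
Qed.

Lemma A_cospectral_subdivision_power k (G G' : hypergraph) r :
    3 <= k -> uniform 2 G -> uniform 2 G' ->
    (forall v : G, degree v = r) -> (forall v : G', degree v = r) ->
    #|edge_type G| = #|edge_type G'| -> A_cospectral 2 G G' ->
  A_cospectral k (subdivision (power k G)) (subdivision (power k G')).
Proof.
move=> k3 G2 G2' Gr Gr' EE coG; have GG := A_cospectral_card coG.
apply/A_cospectralP/(poly_eq_off_roots (cell_poly_neq0 k)) => x gx.
rewrite !(horner_char_poly_subdivision_power k3 _ _ gx (r := r)) //.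
rewrite (fdet_edge_block_card _ _ EE) !det_scalar_sub.
by move/A_cospectralP: coG => ->; rewrite GG.
Qed.

Theorem theorem8 (k : nat) (G G' : hypergraph) :
  3 <= k ->
  uniform 2 G -> uniform 2 G' ->
  regular G -> regular G' ->
  ~ isomorphic G G' ->
  A_cospectral 2 G G' ->
  ~ isomorphic (subdivision (power k G)) (subdivision (power k G')) /\
  A_cospectral k (subdivision (power k G)) (subdivision (power k G')).
Proof.
move=> k3 G2 G2' regG regG' nisoG coG.
have [r [Gr Gr']] := A_cospectral_regular G2 G2' regG regG' coG.
have GG := A_cospectral_card coG.
have EE : #|edge_type G| = #|edge_type G'|.
  (* Twice the number of edges is [r] times the order, on both sides. *)
  apply/eqP; rewrite -(eqn_pmul2r (isT : 0 < 2)) -!degree_sum //.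
  rewrite (eq_bigr _ (fun v _ => Gr v)) (eq_bigr _ (fun v _ => Gr' v)).
  by rewrite !sum_nat_const GG.
split; last exact: A_cospectral_subdivision_power Gr Gr' EE coG.
(* For [r = 1] degrees no longer separate the vertices of [G] from the new power vertices, so small
   degrees are settled by counting. *)
move=> isoS; apply: nisoG; case: r Gr Gr' => [|[|r]] Gr Gr'.
- exact: edgeless_isomorphic Gr Gr' GG.
- exact: matching_isomorphic Gr Gr' EE.
- exact: isomorphic_subdivision_power Gr Gr' GG isoS.
Qed.
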